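(* Let $m\ge3$, $k\in\{2,\dots,m-1\}$, and let $g:\mathbb{T}_m\to\mathbb{R}$ be bounded below. Then the $k$-quasiconvex envelope $u_g^\star$ of $g$ is the largest solution $u:\mathbb{T}_m\to\mathbb{R}$ of the problem $$\begin{cases}\displaystyle u(x)\le\min_{\substack{y_1,\dots,y_k\in\mathcal{S}(x)\\ y_i\ne y_l \text{ for } i\neq l}}\ \max_{i=1,\dots,k}u(y_i) & \text{for all } x\in\mathbb{T}_m,\\[6pt] u(x)\le g(x) & \text{for all } x\in\mathbb{T}_m,\end{cases}$$ that is, $u_g^\star$ satisfies these inequalities and every $u$ satisfying them has $u\le u_g^\star$ on $\mathbb{T}_m$. Let $CS(g)=\{x\in\mathbb{T}_m: u_g^\star(x)=g(x)\}$. For every $x\in CS(g)$, $$g(x)\le\min_{\substack{y_1,\dots,y_k\in\mathcal{S}(x)\\ y_i\ne y_l \text{ for } i\neq l}}\ \max_{i=1,\dots,k}g(y_i),$$ and for every $x\in\mathbb{T}_m\setminus CS(g)$, $$u_g^\star(x)=\min_{\substack{y_1,\dots,y_k\in\mathcal{S}(x)\\ y_i\ne y_l \text{ for } i\neq l}}\ \max_{i=1,\dots,k}u_g^\star(y_i).$$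
   Context: The regular tree $\mathbb{T}_m$ with $m$-branching is the infinite directed graph whose vertices are the empty sequence $\emptyset$ (the root) and all finite sequences $(a_1,\dots,a_l)$, $l\in\mathbb{N}$, with $a_i\in\{0,1,\dots,m-1\}$. Each vertex $x$ has exactly $m$ successors, obtained by appending one coordinate: $\mathcal{S}(x)=\{(x,i): i\in\{0,\dots,m-1\}\}$; edges go from a vertex to its successors. For a vertex $x$, $\mathbb{T}_k^x$ denotes the collection of finite directed subgraphs (subtrees) $\mathbb{B}$ of $\mathbb{T}_m$ with root $x$ and $k$-branching, i.e. every node of $\mathbb{B}$ that is not a terminal node has exactly $k$ successors in $\mathbb{B}$; $\mathcal{E}(\mathbb{B})$ is the set of terminal nodes of $\mathbb{B}$. A set $C\subset\mathbb{T}_m$ is $k$-convex if for every vertex $x$ and every $\mathbb{B}\in\mathbb{T}_k^x$ with $\mathcal{E}(\mathbb{B})\subset C$ one has $x\in C$. A function $u:\mathbb{T}_m\to\mathbb{R}$ is $k$-quasiconvex if for every $\alpha\in\mathbb{R}$ the set $\{x\in\mathbb{T}_m: u(x)\le\alpha\}$ is $k$-convex. The $k$-quasiconvex envelope of $g:\mathbb{T}_m\to\mathbb{R}$ is $u_g^\star(x)=\sup\{u(x): u\in\mathfrak{QC}_k(g)\}$, where $\mathfrak{QC}_k(g)$ is the set of all $k$-quasiconvex $u:\mathbb{T}_m\to\mathbb{R}$ with $u(x)\le g(x)$ for all $x\in\mathbb{T}_m$. *)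

(* Defs.v *)
From mathcomp Require Import all_boot all_order all_algebra finmap.
From mathcomp Require Import all_classical all_reals.
Set Implicit Arguments.
Unset Strict Implicit.
Unset Printing Implicit Defensive.
Import Order.TTheory GRing.Theory Num.Theory.
Local Open Scope fset_scope.
Local Open Scope classical_set_scope.
Local Open Scope ring_scope.

(* T_m: the root is [::], and the child (x, i) of x is rcons x i. *)
Notation vertex m := (seq 'I_m).

Definition successors (m : nat) (x : vertex m) : {fset vertex m} :=
  [fset rcons x i | i in 'I_m]%fset.

Definition edge (m : nat) : rel (vertex m) := fun x y => y \in successors x.

Definition terminal_nodes (m : nat) (B : {fset vertex m}) : {fset vertex m} :=
  [fset y in B | (successors y `&` B)%fset == fset0]%fset.

(* A subtree is given by its vertex set: every vertex of T_m has at most one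
   predecessor, so a directed subgraph in which every node is reached from the
   root x contains every edge of T_m between two of its nodes. *)
Definition branching_subtree (m k : nat) (x : vertex m) (B : {fset vertex m}) :
    Prop :=
  [/\ x \in B,
      forall y, y \in B ->
        exists p : seq (vertex m),
          [/\ path (@edge m) x p, {subset p <= B} & last x p = y]
    & forall y, y \in B -> y \notin terminal_nodes B ->
        #|` (successors y `&` B)%fset | = k].

Definition kconvex (m k : nat) (C : set (vertex m)) : Prop :=
  forall (x : vertex m) (B : {fset vertex m}),
    branching_subtree k x B -> [set` terminal_nodes B] `<=` C -> C x.

Definition kquasiconvex (R : realType) (m k : nat) (u : vertex m -> R) : Prop :=
  forall alpha : R, kconvex k [set x | u x <= alpha].

Definition kquasiconvex_minorants (R : realType) (m k : nat)
    (g : vertex m -> R) : set (vertex m -> R) :=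
  [set u | kquasiconvex k u /\ forall x, u x <= g x].

(* [sup] is the supremum in R, with junk value 0 on sets that are empty or not
   bounded above; for g bounded below the constants below inf g are minorants,
   and g x is an upper bound, so the junk value does not occur. *)
Definition kquasiconvex_envelope (R : realType) (m k : nat)
    (g : vertex m -> R) (x : vertex m) : R :=
  sup [set u x | u in kquasiconvex_minorants k g].

(* Minimum over the k-tuples of pairwise distinct successors of x. It is taken
   in \bar R only so that the iterated operators have neutral elements; it is a
   real number as soon as 0 < k <= m. *)
Definition min_max_successors (R : realType) (m k : nat) (u : vertex m -> R)
    (x : vertex m) : \bar R :=
  \big[Order.min/+oo%E]_(y : {ffun 'I_k -> successors x} | injectiveb y)
    \big[Order.max/-oo%E]_(i < k) (u (fsval (y i)))%:E.

Definition obstacle_solution (R : realType) (m k : nat) (g u : vertex m -> R) :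
    Prop :=
  (forall x, ((u x)%:E <= min_max_successors k u x)%E) /\
  (forall x, u x <= g x).

Definition contact_set (R : realType) (m k : nat) (g : vertex m -> R) :
    set (vertex m) :=
  [set x | kquasiconvex_envelope k g x = g x].

(* Main.v *)
Require Import Defs.
From mathcomp Require Import all_boot all_order all_algebra finmap.
From mathcomp Require Import all_classical all_reals.
Set Implicit Arguments.
Unset Strict Implicit.
Unset Printing Implicit Defensive.
Import Order.TTheory GRing.Theory Num.Theory.
Local Open Scope classical_set_scope.
Local Open Scope ring_scope.

(** The theorem rests on a local description of a global notion: for [k > 0], a
    function [u] is k-quasiconvex iff [u x] is at most the largest value of [u]
    on any [k] distinct successors of [x] ([kquasiconvexP]). One direction tests
    convexity on the subtree of height one formed by [x] and the [k] successors;
    the other propagates a bound on the terminal nodes of a finite subtree down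
    to its root, one generation at a time ([branching_subtree_ind]). Hence the
    solutions of the obstacle problem are exactly the k-quasiconvex minorants of
    [g].

    The rest is Perron's method. The local condition is preserved by pointwise
    suprema, because its right-hand side is monotone in [u]; as [g] is bounded
    below, minorants exist and their supremum, the envelope, is the largest
    solution. On the contact set the inequality for [g] follows from
    the one for the envelope, again by monotonicity. Off the contact set,
    raising the envelope at the single vertex [x] to the smaller of [g x] and
    the min-max of the envelope at [x] still gives a solution, since [x] is
    not among its own successors; maximality of the envelope then forces the
    envelope at [x] to be at least the min-max
    ([le_kquasiconvex_envelope_at]). *)

(** * The successor structure of the tree *)

Lemma size_successor (m : nat) (x y : vertex m) :
  y \in successors x -> size y = (size x).+1.
Proof. by case/imfsetP => i _ ->; rewrite size_rcons. Qed.

(** Bounds on the [k]-ary min-max are handled throughout in this quantifier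
    form, which removes the extended reals. *)
Lemma le_min_max_successorsP (R : realType) (m k : nat) (u : vertex m -> R)
    (x : vertex m) (a : R) :
  (a%:E <= min_max_successors k u x)%E <->
  (forall y : {ffun 'I_k -> successors x}, injective y ->
     exists i, a <= u (fsval (y i))).
Proof.
split.
- case/bigmin_geP => _ le_a y /injectiveP/le_a /bigmax_geP.
  by case => [|[i _]]; rewrite ?leeNy_eq// lee_fin => ?; exists i.
- move=> le_a; apply/bigmin_geP; split=> [|y /injectiveP/le_a [i le_ai]].
    exact: leey.
  by apply/bigmax_geP; right; exists i.
Qed.

Lemma le_min_max_successors (R : realType) (m k : nat) (u v : vertex m -> R)
    (x : vertex m) :
  (forall y, y \in successors x -> u y <= v y) ->
  (min_max_successors k u x <= min_max_successors k v x)%E.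
Proof.
move=> le_uv; apply: le_bigmin2 => y _; apply: le_bigmax2 => i _.
by rewrite lee_fin le_uv// fsvalP.
Qed.

(** * Local characterization of quasiconvexity *)

(** Induction from the terminal nodes to the root terminates because the length
    of the vertices of the finite set [B] is bounded. *)
Lemma branching_subtree_ind (m k : nat) (x : vertex m) (B : {fset vertex m})
    (P : vertex m -> Prop) :
  branching_subtree k x B ->
  (forall y, y \in terminal_nodes B -> P y) ->
  (forall y, #|` (successors y `&` B)%fset| = k ->
     (forall z, z \in (successors y `&` B)%fset -> P z) -> P y) ->
  P x.
Proof.
case=> xB _ branchB Pterm Pstep.
pose N := \max_(y <- B) size y.
have le_sizeN y : y \in B -> (size y <= N)%N.
  by move=> yB; apply: (leq_bigmax_seq (F := fun y : vertex m => size y)).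
suff H n y : (N - size y < n)%N -> y \in B -> P y by apply: (H _ x (leqnn _)).
elim: n y => [//|n IHn] y ltn yB.
have [/Pterm//|/(branchB _ yB) cardk] := boolP (y \in terminal_nodes B).
apply: Pstep => // z; rewrite inE => /andP[/size_successor sz zB].
apply: IHn => //; rewrite sz; move: (le_sizeN z zB); rewrite sz => ltN.
by rewrite -ltnS; apply: leq_trans ltn; rewrite ltnS ltn_sub2l.
Qed.

(** The test trees of height one. The successors of a vertex of [S] lie two
    generations below [x], hence outside the tree, which makes [S] terminal. *)
Lemma branching_subtree_star (m k : nat) (x : vertex m) (S : {fset vertex m}) :
  (0 < k)%N -> (S `<=` successors x)%fset -> #|` S| = k ->
  branching_subtree k x (x |` S)%fset /\ terminal_nodes (x |` S)%fset = S.
Proof.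
move=> k0 /fsubsetP sS cardS.
have succx : (successors x `&` (x |` S) = S)%fset.
  apply/fsetP => z; rewrite !inE; apply/andP/idP => [[/size_successor sz]|zS].
    by case/orP => // /eqP zx; move: sz; rewrite zx => /n_Sn.
  by rewrite zS orbT sS.
have succS z : z \in S -> (successors z `&` (x |` S) = fset0)%fset.
  move=> /sS/size_successor sz; apply/fsetP => w; rewrite !inE.
  apply/negP => /andP[/size_successor sw /orP[/eqP wx|/sS/size_successor]].
    by move: sw; rewrite wx sz => /eqP; rewrite ltn_eqF.
  by rewrite sw sz; case=> /esym/n_Sn.
have S0 : S != fset0 by rewrite -cardfs_gt0 cardS.
have termS : terminal_nodes (x |` S)%fset = S.
  apply/fsetP => z; rewrite !inE; apply/andP/idP.
    by case=> /orP[/eqP->|//]; rewrite succx (negPf S0).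
  by move=> zS; rewrite zS orbT succS.
split=> //; split.
- by rewrite !inE eqxx.
- move=> z; rewrite !inE => /orP[/eqP->|zS]; first by exists [::].
  exists [:: z]; split=> //=; first by rewrite andbT /edge sS.
  by move=> w; rewrite !inE => /eqP->; rewrite zS orbT.
- move=> z; rewrite termS !inE => /orP[/eqP->|->//]; by rewrite succx cardS.
Qed.

(** Convexity only has to be tested on subtrees of height one, because every
    nonterminal node of a larger subtree is the root of one of them. *)
Lemma kquasiconvexP (R : realType) (m k : nat) (u : vertex m -> R) :
  (0 < k)%N ->
  kquasiconvex k u <->
  (forall x, ((u x)%:E <= min_max_successors k u x)%E).
Proof.
move=> k0; split=> [qu x|le_u alpha x B treeB termB].
- apply/le_min_max_successorsP => y y_inj.
  pose S := [fset fsval (y i) | i in 'I_k]%fset.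
  have cardS : #|` S| = k.
    by rewrite card_imfset /= -?cardE ?card_ord// => i j /val_inj/y_inj.
  have sS : (S `<=` successors x)%fset.
    by apply/fsubsetP => z /imfsetP[i _ ->]; apply: fsvalP.
  have [tree term] := branching_subtree_star k0 sS cardS.
  have [i _ max_i] :=
    @arg_maxP _ _ 'I_k (Ordinal k0) xpredT (fun i => u (fsval (y i))) isT.
  exists i; apply: (qu (u (fsval (y i))) x _ tree).
  by move=> z /=; rewrite term => /imfsetP[j _ ->]; apply: max_i.
- apply: (branching_subtree_ind treeB) => [y /termB//|y cardk le_succ] /=.
  set S := (successors y `&` B)%fset in cardk le_succ.
  have nthS (i : 'I_k) : nth y S i \in S by rewrite mem_nth// cardk.
  have nth_succ (i : 'I_k) : nth y S i \in successors y.
    by case/fsetIP: (nthS i).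
  have /le_min_max_successorsP := le_u y.
  case/(_ [ffun i : 'I_k => [` nth_succ i]%fset]) => [i j|i].
    rewrite !ffunE => /(congr1 val)/eqP /=.
    by rewrite nth_uniq ?cardk// => /eqP/val_inj.
  rewrite ffunE => le_uy; apply: le_trans le_uy _; exact: le_succ (nthS i).
Qed.

Lemma kquasiconvex_minorantP (R : realType) (m k : nat) (g u : vertex m -> R) :
  (0 < k)%N -> kquasiconvex_minorants k g u <-> obstacle_solution k g u.
Proof. by move=> k0; split=> -[/(kquasiconvexP _ k0)]. Qed.

(** * The envelope as a supremum of solutions *)

Lemma obstacle_solution_le_envelope (R : realType) (m k : nat)
    (g u : vertex m -> R) (x : vertex m) :
  (0 < k)%N -> obstacle_solution k g u -> u x <= kquasiconvex_envelope k g x.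
Proof.
move=> k0 /(kquasiconvex_minorantP _ _ k0) u_min; apply: ub_le_sup.
  by exists (g x) => _ [v [_ le_vg] <-].
by exists u.
Qed.

(** A lower bound of [g] is a constant solution, so the supremum is over a
    nonempty set. *)
Lemma kquasiconvex_envelope_le (R : realType) (m k : nat) (g : vertex m -> R)
    (x : vertex m) (b : R) :
  (0 < k)%N -> has_lbound (range g) ->
  (forall u, obstacle_solution k g u -> u x <= b) ->
  kquasiconvex_envelope k g x <= b.
Proof.
move=> k0 [c c_lb] le_b; apply: ge_sup.
- exists c; exists (cst c) => //; apply/kquasiconvex_minorantP => //.
  split=> z; last by apply: c_lb; exists z.
  by apply/le_min_max_successorsP => y _; exists (Ordinal k0).
- by move=> _ [u /(kquasiconvex_minorantP _ _ k0) u_sol <-]; apply: le_b.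
Qed.

(** Each solution satisfies the local inequality with the envelope on the
    right-hand side, by monotonicity; so does their supremum. *)
Lemma kquasiconvex_envelope_solution (R : realType) (m k : nat)
    (g : vertex m -> R) :
  (0 < k)%N -> has_lbound (range g) ->
  obstacle_solution k g (kquasiconvex_envelope k g).
Proof.
move=> k0 g_lb; split=> x; last first.
  by apply: kquasiconvex_envelope_le => // u [].
apply/le_min_max_successorsP => y y_inj.
have [i _ max_i] := @arg_maxP _ _ 'I_k (Ordinal k0) xpredT
  (fun i => kquasiconvex_envelope k g (fsval (y i))) isT.
exists i; apply: kquasiconvex_envelope_le => // u u_sol.
have /le_min_max_successorsP/(_ y y_inj)[j le_uj] := u_sol.1 x.
apply: (le_trans le_uj); apply: le_trans (max_i j isT).
exact: obstacle_solution_le_envelope.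
Qed.

(** If [a] exceeded the envelope at [x], raising the envelope to [a] at the
    single vertex [x] would give a larger solution: the constraint at [x] only
    involves the unchanged values at its successors, and at the other vertices
    the right-hand side can only increase. *)
Lemma le_kquasiconvex_envelope_at (R : realType) (m k : nat)
    (g : vertex m -> R) (x : vertex m) (a : R) :
  (0 < k)%N -> has_lbound (range g) -> a <= g x ->
  (a%:E <= min_max_successors k (kquasiconvex_envelope k g) x)%E ->
  a <= kquasiconvex_envelope k g x.
Proof.
move=> k0 g_lb le_ag le_a; set U := kquasiconvex_envelope k g in le_a *.
have [U_loc U_le] := kquasiconvex_envelope_solution k0 g_lb.
rewrite leNgt; apply/negP => lt_Ua.
pose v z := if z == x then a else U z.
have le_Uv z : U z <= v z by rewrite /v; case: eqP => [->|//]; apply: ltW.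
suff /(obstacle_solution_le_envelope x k0) : obstacle_solution k g v.
  by rewrite /v eqxx leNgt lt_Ua.
split=> z; last by rewrite /v; case: eqP => [->|].
have le_mm : (min_max_successors k U z <= min_max_successors k v z)%E.
  by apply: le_min_max_successors.
apply: le_trans le_mm; rewrite /v; case: eqP => [->//|_]; exact: U_loc.
Qed.

Theorem theorem2p7 (R : realType) (m k : nat) (g : vertex m -> R)
    (hm : (3 <= m)%N) (hk : (2 <= k <= m - 1)%N)
    (hg : has_lbound (range g)) :
  [/\ obstacle_solution k g (kquasiconvex_envelope k g),
      forall u : vertex m -> R, obstacle_solution k g u ->
        forall x, u x <= kquasiconvex_envelope k g x,
      forall x, contact_set k g x ->
        ((g x)%:E <= min_max_successors k g x)%E
    & forall x, ~ contact_set k g x ->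
        (kquasiconvex_envelope k g x)%:E
        = min_max_successors k (kquasiconvex_envelope k g) x].
Proof.
have k0 : (0 < k)%N by case/andP: hk => /ltnW.
have [U_loc U_le] := kquasiconvex_envelope_solution k0 hg.
split=> // [u u_sol x|x /= contact|x /= /eqP noncontact].
- exact: obstacle_solution_le_envelope.
- rewrite -{1}contact; apply: le_trans (U_loc x) _.
  exact: le_min_max_successors.
- apply/eqP; rewrite eq_le U_loc /=.
  have lt_Ug : kquasiconvex_envelope k g x < g x.
    by rewrite lt_neqAle noncontact U_le.
  have le_at a := @le_kquasiconvex_envelope_at _ _ _ g x a k0 hg.
  move: (U_loc x) le_at; case: (min_max_successors _ _ x) => [r||//].
  + move=> le_Ur le_at; rewrite lee_fin.
    (* The alternative [g x <= r] would put [x] in the contact set. *)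
    have [le_rg|/ltW le_gr] := leP r (g x); first exact: le_at.
    by move: (le_at _ (lexx _) le_gr); rewrite leNgt lt_Ug.
  + by move=> _ /(_ _ (lexx _) (leey _)); rewrite leNgt lt_Ug.
Qed.
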